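(* Let $\mathrm{BP}$ be a binary program in $n$ variables with constraints $Ax\leq b$, $x\in\{0,1\}^n$ ($A$ a real matrix with $n$ columns, $b$ a real vector of matching size). Suppose that there exist $\bar{x},\bar{y}\in\operatorname{Fes}(\mathrm{BP})$ such that $\bar{x}+\bar{y}\leq e$. Also suppose that $Mx=d$, where $M\in\mathbb{R}^{m\times n}$ and $d\in\mathbb{R}^{m}$, is a minimal equation system of $P^{n}_{\mathrm{BP}}$. Let $O_{2m\times n}$ be the $2m\times n$ zero matrix, and define $\hat{M}:=[\,M\oplus M\ \ O_{2m\times n}\,]\in\mathbb{R}^{2m\times 3n}$ and $\hat{d}:=d\oplus d\in\mathbb{R}^{2m}$. Then $\hat{M}(x\oplus y\oplus z)=\hat{d}$ is a minimal equation system for $P^{n}_{\overline{\mathrm{BPD}}}$ and, hence, $\dim P^{n}_{\overline{\mathrm{BPD}}}=3n-2\operatorname{rank}M$.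
   Context: $\operatorname{Fes}(\mathrm{BP})=\{x\in\{0,1\}^n: Ax\leq b\}$ and $P^{n}_{\mathrm{BP}}=\operatorname{conv}(\operatorname{Fes}(\mathrm{BP}))\subseteq\mathbb{R}^n$. $e$ is the all-ones vector and inequalities between vectors are entrywise. For vectors, $\oplus$ denotes concatenation; for matrices, $M\oplus M$ is the block-diagonal matrix with two diagonal blocks $M$. The diameter polytope is $P^{n}_{\overline{\mathrm{BPD}}}=\operatorname{conv}\{x\oplus y\oplus z\in\{0,1\}^{3n}: Ax\leq b,\ Ay\leq b,\ x+y-z\leq e\}\subseteq\mathbb{R}^{3n}$. A minimal equation system of a (non-full-dimensional) polytope $P\subseteq\mathbb{R}^N$ is a system $Mx=d$ that is a largest possible collection of linearly independent equations satisfied by all points of $P$. The dimension of a polytope is the dimension of its affine hull. *)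

(* Defs.v *)
From HB Require Import structures.
From mathcomp Require Import all_boot all_order all_algebra.
From mathcomp Require Import boolp classical_sets reals convex.

Set Implicit Arguments.
Unset Strict Implicit.
Unset Printing Implicit Defensive.

Import Order.TTheory GRing.Theory Num.Theory.
Local Open Scope classical_set_scope.
Local Open Scope ring_scope.

Definition vec_le (R : realType) (n : nat) (u v : 'cV[R]_n) : Prop :=
  forall i, u i 0 <= v i 0.

Definition binary_vec (R : realType) (n : nat) (x : 'cV[R]_n) : Prop :=
  forall i, x i 0 = 0 \/ x i 0 = 1.

Definition Fes (R : realType) (p n : nat) (A : 'M[R]_(p, n)) (b : 'cV[R]_p) :
    set 'cV[R]_n :=
  [set x | binary_vec x /\ vec_le (A *m x) b].

Definition conv_hull (R : realType) (n : nat) (S : set 'cV[R]_n) :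
    set 'cV[R]_n :=
  smallest (@convex_set R 'cV[R]_n) S.

Definition P_BP (R : realType) (p n : nat) (A : 'M[R]_(p, n)) (b : 'cV[R]_p) :
    set 'cV[R]_n :=
  conv_hull (Fes A b).

(* The ambient space R^(3n) is 'cV[R]_(n + n + n). *)
Definition P_BPD (R : realType) (p n : nat) (A : 'M[R]_(p, n)) (b : 'cV[R]_p) :
    set 'cV[R]_(n + n + n) :=
  conv_hull [set w | exists x y z : 'cV[R]_n,
    [/\ w = col_mx (col_mx x y) z,
        binary_vec w,
        vec_le (A *m x) b,
        vec_le (A *m y) b &
        vec_le (x + y - z) (const_mx 1)]].

(* An equation a x = beta is identified with the row (a, beta), so linear
   independence of the equations is that of the rows of the augmented matrix. *)
Definition independent_equations (R : realType) (m N : nat)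
    (M : 'M[R]_(m, N)) (d : 'cV[R]_m) : Prop :=
  row_free (row_mx M d).

Definition valid_equations (R : realType) (m N : nat) (P : set 'cV[R]_N)
    (M : 'M[R]_(m, N)) (d : 'cV[R]_m) : Prop :=
  forall x, P x -> M *m x = d.

Definition minimal_equation_system (R : realType) (m N : nat)
    (P : set 'cV[R]_N) (M : 'M[R]_(m, N)) (d : 'cV[R]_m) : Prop :=
  [/\ valid_equations P M d,
      independent_equations M d &
      forall (m' : nat) (M' : 'M[R]_(m', N)) (d' : 'cV[R]_m'),
        valid_equations P M' d' -> independent_equations M' d' ->
        (m' <= m)%N].

Definition affine_set (R : realType) (N : nat) (A : set 'cV[R]_N) : Prop :=
  forall x y (t : R), A x -> A y -> A (t *: x + (1 - t) *: y).

Definition affine_hull (R : realType) (N : nat) (S : set 'cV[R]_N) :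
    set 'cV[R]_N :=
  smallest (@affine_set R N) S.

(* The affine hull of S is a translate of a k-dimensional linear subspace; no k
   qualifies when S is empty. *)
Definition has_dim (R : realType) (N : nat) (S : set 'cV[R]_N) (k : nat) :
    Prop :=
  exists (c : 'cV[R]_N) (V : {vspace 'cV[R]_N}),
    affine_hull S = [set x | x - c \in V] /\ \dim V = k.

Lemma has_dim_unique (R : realType) (N : nat) (S : set 'cV[R]_N) (k l : nat) :
  has_dim S k -> has_dim S l -> k = l.
Proof.
case=> c [V [hV <-]] [c' [W [hW <-]]].
have E x : (x - c \in V) = (x - c' \in W).
  have /(congr1 (fun F : set _ => F x)) /= H := etrans (esym hV) hW.
  by apply/idP/idP; rewrite H.
have cW : c - c' \in W by rewrite -E subrr mem0v.
congr (\dim _); apply/vspaceP => v; have := E (v + c); rewrite addrK => ->.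
by rewrite -addrA rpredDr.
Qed.

(* Main.v *)
Require Import Defs.
From mathcomp Require Import all_boot all_order all_algebra.
From mathcomp Require Import boolp classical_sets reals convex.
From mathcomp Require Import unstable zify ring.

Set Implicit Arguments.
Unset Strict Implicit.
Unset Printing Implicit Defensive.

Import Order.TTheory GRing.Theory Num.Theory.
Local Open Scope ring_scope.

(** Since linear equations pass to convex hulls, everything is decided on 0/1
    points. Let [a1 x + a2 y + a3 z = beta] be an equation valid on the diameter
    polytope. The feasible pair [(xbar, ybar)] with [xbar + ybar <= e] may be
    completed by every binary [z], so [a3 z] does not depend on [z] and
    [a3 = 0]. Conversely the slack [z = e] makes the coupling constraint
    [x + y - z <= e] vacuous, so [a1 x + a2 y = beta] for all feasible [x] and
    [y] chosen independently: [a1 x] and [a2 y] are separately constant on the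
    feasible set ([P_BPD_equation_split]). By minimality of [M x = d], both of
    these equations are combinations of rows of [(M, d)]
    ([minimal_system_sub]), hence the given one is a combination of rows of
    [(Mhat, dhat)]. A valid independent system whose rows span all valid
    equations is minimal ([spanning_system_minimal]).

    The dimension formula holds for a minimal system [M x = d] of any nonempty
    set in dimension [N] ([minimal_system_has_dim]). The affine hull is a
    translate of a subspace [V]. On one hand [M] has independent rows and
    vanishes on [V], so [rank M + dim V <= N]; on the other hand the annihilator
    of [V] supplies [N - dim V] independent valid equations, so
    [N - dim V <= rank M] by maximality. For the diameter polytope this is
    applied with [Mhat], whose rows are independent because those of [M] are. *)

(** * Equations valid on a convex hull *)

Lemma conv_hull_gen (R : realType) (N : nat) (S : set 'cV[R]_N)
    (x : 'cV[R]_N) :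
  S x -> conv_hull S x.
Proof. by move=> Sx; apply: (@sub_gen_smallest _ _ S x Sx). Qed.

Lemma valid_conv_hull (R : realType) (k N : nat) (S : set 'cV[R]_N)
    (M : 'M[R]_(k, N)) (d : 'cV[R]_k) :
  (forall x, S x -> M *m x = d) -> valid_equations (conv_hull S) M d.
Proof.
move=> h; apply: (smallest_sub (X := [set x | M *m x = d]%classic)) => //.
move=> x y l; rewrite !inE /= => hx hy.
rewrite /conv /= mulmxDr -!scalemxAr hx hy -scalerDl.
by rewrite add_onemK scale1r.
Qed.

(** * The row space of a minimal system *)

(** In this homogeneous form validity is visibly inherited by every system
    whose augmented rows lie in the row space of [(M, d)]. *)
Lemma valid_equationsE (R : realType) (k N : nat) (P : set 'cV[R]_N)
    (M : 'M[R]_(k, N)) (d : 'cV[R]_k) :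
  valid_equations P M d <->
  forall x, P x -> row_mx M d *m col_mx x (- 1%:M) = 0.
Proof.
split=> h x Px; first by rewrite mul_row_col (h x Px) mulmxN mulmx1 subrr.
by have /eqP := h x Px; rewrite mul_row_col mulmxN mulmx1 subr_eq0 => /eqP.
Qed.

(** Otherwise stacking the two systems and extracting a row basis would yield
    more independent valid equations than the minimal system has. *)
Lemma minimal_system_sub (R : realType) (k l N : nat) (P : set 'cV[R]_N)
    (M : 'M[R]_(k, N)) (d : 'cV[R]_k) (M' : 'M[R]_(l, N)) (d' : 'cV[R]_l) :
  minimal_equation_system P M d -> valid_equations P M' d' ->
  (row_mx M' d' <= row_mx M d)%MS.
Proof.
case=> /valid_equationsE vM free_M maxM /valid_equationsE vM'.
pose E := row_base (col_mx (row_mx M d) (row_mx M' d')).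
have vE : valid_equations P (lsubmx E) (rsubmx E).
  apply/valid_equationsE => x Px; rewrite hsubmxK.
  have /submxP[X ->] : (E <= col_mx (row_mx M d) (row_mx M' d'))%MS.
    by rewrite /E eq_row_base.
  by rewrite -mulmxA mul_col_mx vM // vM' // col_mx0 mulmx0.
have := maxM _ _ _ vE; rewrite /independent_equations hsubmxK row_base_free.
move=> /(_ isT) leEk.
have subM : (row_mx M d <= col_mx (row_mx M d) (row_mx M' d'))%MS.
  apply/submxP; exists (row_mx 1%:M 0).
  by rewrite mul_row_col mul1mx mul0mx addr0.
have subM' : (row_mx M' d' <= col_mx (row_mx M d) (row_mx M' d'))%MS.
  apply/submxP; exists (row_mx 0 1%:M).
  by rewrite mul_row_col mul1mx mul0mx add0r.
apply: submx_trans subM' _; rewrite -(geq_leqif (mxrank_leqif_sup subM)).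
by rewrite (eqP free_M).
Qed.

Lemma spanning_system_minimal (R : realType) (k N : nat) (P : set 'cV[R]_N)
    (M : 'M[R]_(k, N)) (d : 'cV[R]_k) :
  valid_equations P M d -> independent_equations M d ->
  (forall (l : nat) (M' : 'M[R]_(l, N)) (d' : 'cV[R]_l),
     valid_equations P M' d' -> (row_mx M' d' <= row_mx M d)%MS) ->
  minimal_equation_system P M d.
Proof.
move=> vM free_M span; split=> // l M' d' vM' /eqP <-.
by rewrite (leq_trans (mxrankS (span _ _ _ vM'))) // rank_leq_row.
Qed.

(** Without a point of [P] this fails, since [0 = 1] is then a valid equation:
    a point forces [v M = 0] to imply [v d = v M x = 0]. *)
Lemma independent_row_free (R : realType) (k N : nat) (P : set 'cV[R]_N)
    (M : 'M[R]_(k, N)) (d : 'cV[R]_k) (x : 'cV[R]_N) :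
  P x -> valid_equations P M d -> independent_equations M d -> row_free M.
Proof.
move=> Px /(_ _ Px) <- free_M; apply: inj_row_free => v vM0.
by apply: (row_free_inj free_M); rewrite mul_mx_row mulmxA vM0 !mul0mx row_mx0.
Qed.

Lemma row_free_independent (R : realType) (k N : nat)
    (M : 'M[R]_(k, N)) (d : 'cV[R]_k) :
  row_free M -> independent_equations M d.
Proof.
move=> free_M; apply: inj_row_free => v.
rewrite mul_mx_row -row_mx0 => /eq_row_mx[vM0 _].
by apply: (row_free_inj free_M); rewrite vM0 mul0mx.
Qed.

(** * Dimension from a minimal system *)

(** A linearly closed predicate is turned into an actual [{vspace}]:
    finite dimension makes a subspace of maximal dimension inside [W] exhaust
    [W], as a vector outside it could be adjoined. *)
Lemma vspace_of_closed (R : realType) (N : nat) (W : 'cV[R]_N -> Prop) :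
  W 0 -> (forall (t : R) v, W v -> W (t *: v)) ->
  (forall u v, W u -> W v -> W (u + v)) ->
  exists V : {vspace 'cV[R]_N}, forall v, v \in V <-> W v.
Proof.
move=> W0 WZ WD.
pose dimW k := `[< exists V : {vspace 'cV[R]_N},
  (forall v, v \in V -> W v) /\ \dim V = k >].
have ex_dim : exists k, dimW k.
  exists 0%N; apply/asboolP; exists 0%VS; split; last by rewrite dimv0.
  by move=> v; rewrite memv0 => /eqP->.
have dim_le k : dimW k -> (k <= \dim {:'cV[R]_N})%N.
  by case/asboolP=> V [_ <-]; rewrite dimvS // subvf.
case: (ex_maxnP ex_dim dim_le) => k /asboolP[V [VW dimV]] maxk.
exists V => v; split; first exact: VW.
move=> Wv.
have /maxk : dimW (\dim (V + <[v]>)%VS).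
  apply/asboolP; exists (V + <[v]>)%VS; split=> // u.
  by case/memv_addP=> a aV [_ /vlineP[t ->] ->]; apply: WD (VW _ aV) (WZ _ _ Wv).
rewrite -dimV (geq_leqif (dimv_leqif_sup (addvSl V _))) subv_add.
by case/andP=> _; rewrite -memvE.
Qed.

(** Translating the hull by [c] gives a set closed under scaling, since
    [t v + c] is on the line through [v + c] and [c], and under addition,
    since [u + v] is twice the midpoint of [u] and [v]. *)
Lemma affine_hull_translate (R : realType) (N : nat) (S : set 'cV[R]_N)
    (c : 'cV[R]_N) :
  S c -> exists V : {vspace 'cV[R]_N},
    affine_hull S = [set x | x - c \in V]%classic.
Proof.
move=> Sc.
have Hc : affine_hull S c by apply: (@sub_gen_smallest _ _ S c Sc).
have affH : affine_set (affine_hull S).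
  move=> x y t Hx Hy H HS.
  exact: HS.1 (Hx H HS) (Hy H HS).
pose W v := affine_hull S (v + c).
have WZ (t : R) v : W v -> W (t *: v).
  move=> Wv; rewrite /W.
  have -> : t *: v + c = t *: (v + c) + (1 - t) *: c.
    by rewrite scalerDr -addrA -scalerDl (addrC t) subrK scale1r.
  exact: affH.
have W0 : W 0 by rewrite /W add0r.
have WD u v : W u -> W v -> W (u + v).
  move=> Wu Wv.
  have -> : u + v = (2 : R) *: ((2^-1 : R) *: u + (2^-1 : R) *: v).
    by rewrite -scalerDr scalerA divff ?pnatr_eq0 // scale1r.
  apply: WZ; rewrite /W.
  have -> : 2^-1 *: u + 2^-1 *: v + c
      = (2^-1 : R) *: (u + c) + (1 - 2^-1) *: (v + c).
    have -> : 1 - 2^-1 = 2^-1 :> R by field.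
    rewrite !scalerDr addrACA -scalerDl; congr (_ + _).
    have -> : 2^-1 + 2^-1 = 1 :> R by field.
    by rewrite scale1r.
  exact: affH.
have [V VW] := vspace_of_closed W0 WZ WD.
exists V; apply/seteqP; split=> x /=.
  by move=> Hx; apply/VW; rewrite /W subrK.
by move/VW; rewrite /W subrK.
Qed.

(** Passes from subspaces to matrices, where equations and ranks live. *)
Lemma col_basis_vspace (R : realType) (N : nat) (V : {vspace 'cV[R]_N}) :
  exists C : 'M[R]_(N, \dim V),
    row_free C^T /\ forall v, v \in V <-> exists u, v = C *m u.
Proof.
pose C : 'M[R]_(N, \dim V) := \matrix_(i, j) (vbasis V)`_j i 0.
have CE (u : 'cV_(\dim V)) : C *m u = \sum_j u j 0 *: (vbasis V)`_j.
  apply/colP => i; rewrite mxE summxE; apply: eq_bigr => j _.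
  by rewrite !mxE mulrC.
exists C; split.
  apply: inj_row_free => v /(congr1 trmx); rewrite trmx_mul trmxK trmx0 CE.
  have /freeP free_V := basis_free (vbasisP V).
  by move=> /free_V v0; apply/rowP => j; have := v0 j; rewrite !mxE.
move=> v; split=> [/coord_vbasis vE|[u ->]].
  exists (\col_j coord (vbasis V) j v); rewrite CE {1}vE.
  by apply: eq_bigr => j _; rewrite mxE.
rewrite CE; apply: memv_suml => j _; apply/memvZ/vbasis_mem/mem_nth.
by rewrite size_tuple.
Qed.

(** Both inequalities between [dim V] and [N - rank M] come from pairing [M], and
    then the annihilator of [V], with a basis matrix of [V]. *)
Lemma minimal_system_has_dim (R : realType) (k N : nat) (P : set 'cV[R]_N)
    (M : 'M[R]_(k, N)) (d : 'cV[R]_k) (c : 'cV[R]_N) :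
  P c -> minimal_equation_system P M d -> has_dim P (N - \rank M)%N.
Proof.
move=> Pc [vM free_Md maxM].
have free_M := independent_row_free Pc vM free_Md.
have [V hullE] := affine_hull_translate Pc.
have [C [/eqP rankC CV]] := col_basis_vspace V.
exists c, V; split=> //.
have hull_sol x : affine_hull P x -> M *m x = d.
  apply: (smallest_sub (X := [set x | M *m x = d]%classic)) => // {}x y t /= hx hy.
  by rewrite mulmxDr -!scalemxAr hx hy -scalerDl addrC subrK scale1r.
have MC0 : M *m C = 0.
  apply/matrixP => i j.
  have : C *m delta_mx j 0 \in V by apply/CV; exists (delta_mx j 0).
  rewrite -{1}(addrK c (C *m _)) => CVj.
  have : affine_hull P (C *m delta_mx j (0 : 'I_1) + c) by rewrite hullE.
  move/hull_sol; rewrite mulmxDr (vM c Pc) => /eqP.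
  rewrite -subr_eq0 addrK mulmxA -colE => /eqP/colP/(_ i).
  by rewrite !mxE.
have := mulmx0_rank_max MC0; rewrite -(mxrank_tr C) rankC (eqP free_M).
(* [K] is a basis of the annihilator of [V], hence constant on [P]. *)
pose K := row_base (kermx C).
have vK : valid_equations P K (K *m c).
  move=> x Px; apply/eqP; rewrite -subr_eq0 -mulmxBr.
  have : x - c \in V.
    suff : affine_hull P x by rewrite hullE.
    by apply: (@sub_gen_smallest _ _ P x Px).
  case/CV=> u ->; rewrite mulmxA.
  have /submxP[X ->] : (K <= kermx C)%MS by rewrite eq_row_base.
  by rewrite -(mulmxA X) mulmx_ker mulmx0 mul0mx.
have := maxM _ _ _ vK (row_free_independent _ (row_base_free _)).
rewrite mxrank_ker -(mxrank_tr C) rankC; lia.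
Qed.

(** * Points and equations of the diameter polytope *)

Lemma binary_delta (R : realType) (n : nat) (i : 'I_n) :
  binary_vec (delta_mx i 0 : 'cV[R]_n).
Proof. by move=> j; rewrite mxE; case: (_ && _); [right | left]. Qed.

Lemma binary_col_mx (R : realType) (n k : nat) (x : 'cV[R]_n) (y : 'cV[R]_k) :
  binary_vec x -> binary_vec y -> binary_vec (col_mx x y).
Proof. by move=> hx hy i; rewrite mxE; case: split. Qed.

Lemma binary_ge0 (R : realType) (n : nat) (x : 'cV[R]_n) i :
  binary_vec x -> 0 <= x i 0.
Proof. by move=> /(_ i)[] ->. Qed.

Lemma binary_le1 (R : realType) (n : nat) (x : 'cV[R]_n) i :
  binary_vec x -> x i 0 <= 1.
Proof. by move=> /(_ i)[] ->. Qed.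

Lemma P_BPD_gen (R : realType) (p n : nat) (A : 'M[R]_(p, n))
    (b : 'cV[R]_p) (x y z : 'cV[R]_n) :
  Fes A b x -> Fes A b y -> binary_vec z ->
  vec_le (x + y - z) (const_mx 1) ->
  P_BPD A b (col_mx (col_mx x y) z).
Proof.
move=> [bin_x Ax] [bin_y Ay] bz le1; apply: conv_hull_gen.
by exists x, y, z; split=> //; do 2?apply: binary_col_mx.
Qed.

(** With [x + y <= e] the slack [z] is free, so it can be varied alone. *)
Lemma P_BPD_complementary (R : realType) (p n : nat) (A : 'M[R]_(p, n))
    (b : 'cV[R]_p) (x y z : 'cV[R]_n) :
  Fes A b x -> Fes A b y -> vec_le (x + y) (const_mx 1) -> binary_vec z ->
  P_BPD A b (col_mx (col_mx x y) z).
Proof.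
move=> Fx Fy le1 bz; apply: P_BPD_gen => // i.
apply: le_trans (le1 i).
by rewrite [leLHS]mxE [X in _ + X]mxE gerDl oppr_le0 binary_ge0.
Qed.

(** With full slack the two feasible points are independent of each other. *)
Lemma P_BPD_const1 (R : realType) (p n : nat) (A : 'M[R]_(p, n))
    (b : 'cV[R]_p) (x y : 'cV[R]_n) :
  Fes A b x -> Fes A b y -> P_BPD A b (col_mx (col_mx x y) (const_mx 1)).
Proof.
move=> Fx Fy; apply: P_BPD_gen => // [|i]; first by move=> i; rewrite mxE; right.
by rewrite !mxE lerBlDr lerD // binary_le1 //; [case: Fx | case: Fy].
Qed.

Lemma P_BPD_valid_product (R : realType) (p n : nat) (A : 'M[R]_(p, n))
    (b : 'cV[R]_p) (k : nat) (M : 'M[R]_(k, n)) (d : 'cV[R]_k) :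
  valid_equations (P_BP A b) M d ->
  valid_equations (P_BPD A b) (row_mx (block_mx M 0 0 M) 0) (col_mx d d).
Proof.
move=> vM; apply: valid_conv_hull => _ [x [y [z [-> bw Ax Ay _]]]].
have Fx : Fes A b x.
  by split=> // i; have := bw (lshift n (lshift n i)); rewrite !col_mxEu.
have Fy : Fes A b y.
  by split=> // i; have := bw (lshift n (rshift n i)); rewrite col_mxEu col_mxEd.
rewrite mul_row_col mul0mx addr0 mul_block_col !mul0mx addr0 add0r.
by rewrite !vM //; apply: conv_hull_gen.
Qed.

(** The points with free slack kill [a3]; the points with full slack then let
    [x] and [y] vary one at a time around [xbar] and [ybar], which separates
    [a1] from [a2]. *)
Lemma P_BPD_equation_split (R : realType) (p n : nat) (A : 'M[R]_(p, n))
    (b : 'cV[R]_p) (xbar ybar : 'cV[R]_n) (l : nat)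
    (a1 a2 a3 : 'M[R]_(l, n)) (beta : 'cV[R]_l) :
  Fes A b xbar -> Fes A b ybar -> vec_le (xbar + ybar) (const_mx 1) ->
  valid_equations (P_BPD A b) (row_mx (row_mx a1 a2) a3) beta ->
  [/\ a3 = 0, beta = a1 *m xbar + a2 *m ybar,
      valid_equations (P_BP A b) a1 (a1 *m xbar) &
      valid_equations (P_BP A b) a2 (a2 *m ybar)].
Proof.
move=> Fx Fy le1 va.
have b0 : binary_vec (0 : 'cV[R]_n) by move=> i; rewrite mxE; left.
have a3_0 : a3 = 0.
  apply/matrixP => i j.
  (* Compare the slacks [0] and [delta_mx j 0]: their difference reads off
     column [j] of [a3]. *)
  have := va _ (P_BPD_complementary Fx Fy le1 b0).
  rewrite -(va _ (P_BPD_complementary Fx Fy le1 (binary_delta R j))).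
  rewrite !mul_row_col mulmx0 => /addrI/esym; rewrite -colE => /colP/(_ i).
  by rewrite !mxE.
have vxy x y : Fes A b x -> Fes A b y -> a1 *m x + a2 *m y = beta.
  move=> Fx' Fy'; rewrite -(va _ (P_BPD_const1 Fx' Fy')) a3_0.
  by rewrite !mul_row_col mul0mx addr0.
split=> //; first by rewrite vxy.
  apply: valid_conv_hull => x Fx'; apply: (addIr (a2 *m ybar)).
  by rewrite !vxy.
apply: valid_conv_hull => y Fy'; apply: (addrI (a1 *m xbar)).
by rewrite !vxy.
Qed.

(** * The minimal equation system and the dimension *)

Theorem corollary2p9 (R : realType) (p n m : nat)
    (A : 'M[R]_(p, n)) (b : 'cV[R]_p)
    (hxy : exists xbar ybar : 'cV[R]_n,
      [/\ Fes A b xbar, Fes A b ybar & vec_le (xbar + ybar) (const_mx 1)])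
    (M : 'M[R]_(m, n)) (d : 'cV[R]_m)
    (hM : minimal_equation_system (P_BP A b) M d) :
  let Mhat : 'M[R]_(m + m, n + n + n) :=
    row_mx (block_mx M 0 0 M) (0 : 'M[R]_(m + m, n)) in
  let dhat : 'cV[R]_(m + m) := col_mx d d in
  minimal_equation_system (P_BPD A b) Mhat dhat /\
  has_dim (P_BPD A b) (3 * n - 2 * \rank M)%N.
Proof.
move=> Mhat dhat; have [xbar [ybar [Fx Fy le1]]] := hxy.
have [vM free_Md _] := hM.
have free_M := independent_row_free (conv_hull_gen Fx) vM free_Md.
have free_Mhat : row_free Mhat.
  apply: inj_row_free => v; rewrite -[v]hsubmxK /Mhat mul_mx_row mulmx0.
  rewrite mul_row_block !mulmx0 addr0 add0r -!row_mx0.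
  case/eq_row_mx=> /eq_row_mx[vl vr] _.
  by congr row_mx; apply: (row_free_inj free_M); rewrite ?vl ?vr mul0mx.
have minMhat : minimal_equation_system (P_BPD A b) Mhat dhat.
  apply: spanning_system_minimal.
  - exact: P_BPD_valid_product.
  - exact: row_free_independent.
  move=> l M' d'; rewrite -[M']hsubmxK -[lsubmx M']hsubmxK.
  case/(P_BPD_equation_split Fx Fy le1) => -> -> v1 v2.
  have /submxP[X] := minimal_system_sub hM v1.
  rewrite mul_mx_row => /eq_row_mx[-> ->].
  have /submxP[Y] := minimal_system_sub hM v2.
  rewrite mul_mx_row => /eq_row_mx[-> ->].
  apply/submxP; exists (row_mx X Y).
  rewrite !mul_mx_row mulmx0 mul_row_block mul_row_col.
  by rewrite !mulmx0 addr0 add0r.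
split=> //.
have Pc := P_BPD_const1 Fx Fy.
have := minimal_system_has_dim Pc minMhat.
rewrite (eqP free_Mhat) (eqP free_M).
by congr has_dim; lia.
Qed.
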